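(* Let $H$ be a real Hilbert space, $C\subset H$ a nonempty closed convex set, and let $A,T:H\to H$ be mappings such that: (1) $A$ is monotone and $L$-Lipschitz continuous on $H$ for some $L>0$; (2) $T$ is $\lambda$-demicontractive for some $0\le\lambda<1$, and $I-T$ is demiclosed at zero; (3) $\operatorname{Fix}(T)\cap \mathrm{VI}(C,A)\neq\emptyset$; (4) $\{\theta_k\}_{k\ge1}\subset(0,1)$ satisfies $\lim_{k\to\infty}(1-\theta_k)=0$ and $\sum_{k=1}^\infty(1-\theta_k)=\infty$; $\{\zeta_k\}_{k\ge1}$ is a sequence of positive numbers with $\lim_{k\to\infty}\zeta_k/(1-\theta_k)=0$; and $\{\eta_k\}_{k\ge1}$ is a real sequence such that, for some $a>0$, $\eta_k\in\Big(a,\dfrac{(1-\lambda)\theta_k}{\lambda+\theta_k}\Big)\subset\Big(a,\dfrac{1-\lambda}{1+\lambda}\Big)\subset(a,1-\lambda)$ for all $k$. Let $\delta>0$, $\gamma_1>0$, $\phi\in(0,1)$, let $x^0,x^1\in H$ be arbitrary, and for $k\ge1$ define $$s^k=x^k+\delta_k(x^k-x^{k-1}),\qquad \delta_k=\begin{cases}\min\Big\{\dfrac{\zeta_k}{\|x^k-x^{k-1}\|},\delta\Big\}, & x^k\ne x^{k-1},\\ \delta, & \text{otherwise},\end{cases}$$ $$y^k=P_C(s^k-\gamma_kAs^k),\qquad H_k=\{x\in H:\langle s^k-\gamma_kAs^k-y^k,\,x-y^k\rangle\le0\},\qquad z^k=P_{H_k}(s^k-\gamma_kAy^k),$$ $$x^{k+1}=(1-\eta_k)(\theta_kz^k)+\eta_kTz^k,$$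 $$\gamma_{k+1}=\begin{cases}\min\Big\{\dfrac{\phi\|s^k-y^k\|}{\|As^k-Ay^k\|},\gamma_k\Big\}, & As^k-Ay^k\neq0,\\ \gamma_k, & \text{otherwise}.\end{cases}$$ Then the sequence $\{x^k\}$ converges in norm to $u\in\operatorname{Fix}(T)\cap\mathrm{VI}(C,A)$, where $\|u\|=\min\{\|p\|:p\in\operatorname{Fix}(T)\cap\mathrm{VI}(C,A)\}$.
   Context: $\operatorname{Fix}(T)=\{p\in H:Tp=p\}$. $\mathrm{VI}(C,A)=\{p\in C:\langle Ap,x-p\rangle\ge0\ \ \forall x\in C\}$. $P_D$ is the metric projection of $H$ onto a nonempty closed convex set $D$. $I$ is the identity on $H$. $A$ is monotone if $\langle Ax-Ay,x-y\rangle\ge0$ for all $x,y\in H$, and $L$-Lipschitz continuous if $\|Ax-Ay\|\le L\|x-y\|$ for all $x,y\in H$. $T$ is $\lambda$-demicontractive ($0\le\lambda<1$) if $\|Tx-z\|^2\le\|x-z\|^2+\lambda\|(I-T)x\|^2$ for all $x\in H$ and all $z\in\operatorname{Fix}(T)$. $I-T$ is demiclosed at zero if, for every sequence $\{v^k\}\subset H$, $v^k\rightharpoonup v$ (weakly) and $(I-T)v^k\to0$ (in norm) imply $v\in\operatorname{Fix}(T)$. Superscripts on vectors are sequence indices.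
   Formalization: The inclusions between the intervals for η_k are taken to be proper, which forces λ>0; for λ=0 the claim as written fails, e.g. H=C=ℝ, A=0, T=−I with η_k→1 fast. Quasi-nonexpansive T with η_k bounded away from 1 is still covered by a small λ>0. *)

(* Defs.v *)
From HB Require Import structures.
From mathcomp Require Export all_boot all_order all_algebra sesquilinear.
From mathcomp Require Export all_classical all_reals all_analysis.

Set Implicit Arguments.
Unset Strict Implicit.
Unset Printing Implicit Defensive.

Import Order.TTheory GRing.Theory Num.Theory.
Import numFieldNormedType.Exports.

Local Open Scope classical_set_scope.
Local Open Scope ring_scope.

(* Over R, a form that is Hermitian for the identity is a symmetric bilinear
   form, so {dot H for idfun} is the type of real inner products on H. *)
HB.mixin Record NormedModule_isHilbert (R : realType) H
    of NormedModule R H := {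
  inner : {dot H for idfun} ;
  sqr_norm_inner : forall x : H, `|x| ^+ 2 = inner x x
}.

#[short(type="hilbertType")]
HB.structure Definition Hilbert (R : realType) :=
  {H of CompleteNormedModule R H & NormedModule_isHilbert R H}.

Notation "''[' u , v ]" := (inner u v) : ring_scope.

Section HilbertDefinitions.
Context {R : realType} {H : hilbertType R}.
Implicit Types (C D : set H) (A T : H -> H).

Definition fixpoints T : set H := [set p | T p = p].

Definition VI C A : set H :=
  [set p | C p /\ forall x, C x -> 0 <= '[A p, x - p]].

(* The nearest point exists and is unique when D is nonempty, closed and
   convex; the default value 0 is only used when there is no nearest point. *)
Definition metric_proj D (v : H) : H :=
  xget 0 [set p | D p /\ forall q, D q -> `|v - p| <= `|v - q|].

Definition monotone_map A := forall x y : H, 0 <= '[A x - A y, x - y].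

Definition demicontractive (lambda : R) T := forall x z : H, fixpoints T z ->
  `|T x - z| ^+ 2 <= `|x - z| ^+ 2 + lambda * `|x - T x| ^+ 2.

Definition weakly_cvg (v : nat -> H) (w : H) :=
  forall h : H, '[v k, h] @[k --> \oo] --> '[w, h].

(* This is demiclosedness at zero of I - T. *)
Definition demiclosed_at_zero T := forall (v : nat -> H) (w : H),
  weakly_cvg v w -> (v k - T (v k)) @[k --> \oo] --> (0 : H) -> fixpoints T w.

End HilbertDefinitions.

(* Main.v *)
Require Import Defs.
From mathcomp Require Import ring lra.

Set Implicit Arguments.
Unset Strict Implicit.
Unset Printing Implicit Defensive.

Import Order.TTheory GRing.Theory Num.Theory.
Import numFieldNormedType.Exports.

Local Open Scope classical_set_scope.
Local Open Scope ring_scope.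

(** The iteration is a Halpern iteration with anchor 0 in disguise.  With
    beta_k = (1 - eta_k) (1 - theta_k) and t_k = eta_k / (1 - beta_k),

      x_(k+1) = (1 - beta_k) V_k,   V_k = z_k - t_k (z_k - T z_k),

    so V_k is a relaxed T-step from z_k and x_(k+1) a convex combination of V_k
    and 0.  As 1 - theta_k tends to 0 with a divergent sum, so does beta_k, and
    such an iteration selects the point of the solution set
    S = Fix(T) /\ VI(C, A) nearest to 0.

    Three one-step estimates are combined.  For p in S, the inertial term costs
    |s_k - x_k| <= zeta_k = o(beta_k); the subgradient extragradient step gives
    |z_k - p|^2 <= |s_k - p|^2 - (1 - kappa_k) (|s_k - y_k|^2 + |z_k - y_k|^2)
    ([extragradient_step]), where kappa_k = phi gamma_k / gamma_(k+1) tends to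
    phi < 1 because the adaptive step sizes decrease to a positive limit
    ([adaptive_stepsize]); and the relaxed step gives
    |V_k - p|^2 <= |z_k - p|^2 - t_k (1 - lambda - t_k) |z_k - T z_k|^2
    ([relaxed_demicontractive]), where the bound on eta_k keeps the coefficient
    away from 0 ([relaxation_parameters]; this uses lambda > 0, which the proper
    inclusion of the intervals forces).  Altogether
    |V_k - p|^2 <= |s_k - p|^2 - D_k, with D_k >= 0 controlling all residuals.

    Let u be the projection of 0 onto S, which is closed and convex because Fix(T)
    is an intersection of half-spaces and VI(C, A) is one of C with half-spaces
    ([fixpoints_halfspaces], [VI_minty]).  Then a_k = |x_k - u|^2 satisfies
    a_(k+1) <= (1 - beta_k) a_k + beta_k b_k - D_k / 2, where b_k is
    - 2 <u, x_(k+1) - u> up to o(1).  If D_k is small along a subsequence, then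
    a weak cluster point w of x_(k+1) along it lies in S ([VI_weak_limit] and
    demiclosedness), and <u, w - u> >= 0 makes the limit of b_k nonpositive.
    Hence for each e > 0 and all large k, either b_k <= e or D_k is bounded below
    and outweighs beta_k b_k, since beta_k tends to 0.  Both cases give
    a_(k+1) <= (1 - beta_k) a_k + beta_k e, so limsup a_k <= e
    ([recursion_cvg0]).  The abstract form of this argument is
    [halpern_convergence].

    The Hilbert space theory behind this is built from one fact, that
    |q|^2 - 2 l(q) attains its minimum on a closed convex set for a bounded linear
    l ([quadratic_min_exists]): it yields the metric projection, the Riesz
    representation and, through them, weak sequential compactness of bounded
    sequences ([bounded_weak_subsequence]). *)

(** * Inner products *)

Section InnerProduct.
Context {R : realType} {H : hilbertType R}.
Implicit Types u v w : H.

Lemma innerDl u v w : '[u + v, w] = '[u, w] + '[v, w].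
Proof. exact: linearDl. Qed.

Lemma innerDr w u v : '[w, u + v] = '[w, u] + '[w, v].
Proof. exact: linearDr. Qed.

Lemma innerNl u v : '[- u, v] = - '[u, v].
Proof. exact: linearNl. Qed.

Lemma innerNr u v : '[u, - v] = - '[u, v].
Proof. exact: linearNr. Qed.

Lemma innerZl (c : R) u v : '[c *: u, v] = c * '[u, v].
Proof. exact: linearZl_LR. Qed.

Lemma innerZr (c : R) u v : '[u, c *: v] = c * '[u, v].
Proof. exact: linearZr_LR. Qed.

Lemma innerC u v : '[u, v] = '[v, u].
Proof. by rewrite (hermC inner) expr0 mul1r. Qed.

Definition innerE :=
  (innerDl, innerDr, innerNl, innerNr, innerZl, innerZr).

Lemma inner_ge0 u : 0 <= '[u, u].
Proof. by rewrite -sqr_norm_inner sqr_ge0. Qed.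

Lemma cauchy_schwarz u v : `|'[u, v]| <= `|u| * `|v|.
Proof.
rewrite -(ler_pXn2r (ltn0Sn 1)) ?nnegrE ?mulr_ge0// real_normK ?num_real//.
rewrite exprMn !sqr_norm_inner.
have [->|v0] := eqVneq v 0.
  by rewrite -[X in '[u, X]](scale0r 0) innerZr mul0r expr0n/= -sqr_norm_inner
    -sqr_norm_inner mulr_ge0 ?sqr_ge0.
have vv : 0 < '[v, v] by rewrite -sqr_norm_inner exprn_gt0 ?normr_gt0.
(* |v|^2 u - <u, v> v is |v|^2 times the part of u orthogonal to v; its squared
   norm is |v|^2 (|u|^2 |v|^2 - <u, v>^2). *)
have := inner_ge0 ('[v, v] *: u - '[u, v] *: v).
rewrite !innerE (innerC v u).
set a := '[u, u]; set b := '[v, v]; set c := '[u, v] => h.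
suff : 0 <= b * (a * b - c ^+ 2) by rewrite pmulr_rge0// subr_ge0.
by apply: le_trans h _; rewrite le_eqVlt; apply/orP; left; apply/eqP; ring.
Qed.

Lemma inner_le_norm u v : '[u, v] <= `|u| * `|v|.
Proof. exact: le_trans (ler_norm _) (cauchy_schwarz u v). Qed.

Lemma inner_ge_norm u v : - (`|u| * `|v|) <= '[u, v].
Proof. by have := cauchy_schwarz u v; rewrite ler_norml => /andP[]. Qed.

Lemma cvg_inner_bounded0 {T : Type} {F : set_system T} {FF : Filter F}
    (u v : T -> H) (M : R) :
  (\forall t \near F, `|v t| <= M) -> u @ F --> (0 : H) ->
  '[u t, v t] @[t --> F] --> (0 : R).
Proof.
move=> vM u0.
apply: (@squeeze_cvgr _ _ _ _ (fun t => - (`|u t| * M)) (fun t => `|u t| * M)).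
- near=> t; apply/andP; split; last first.
    by apply: le_trans (inner_le_norm _ _) _; rewrite ler_wpM2l//; near: t.
  apply: le_trans (inner_ge_norm _ _).
  by rewrite lerN2 ler_wpM2l//; near: t.
- rewrite -oppr0; apply: cvgN; rewrite -[X in _ --> X](mul0r M).
  by apply: cvgMr_tmp; rewrite -(@normr0 _ H); exact: cvg_norm.
- rewrite -[X in _ --> X](mul0r M).
  by apply: cvgMr_tmp; rewrite -(@normr0 _ H); exact: cvg_norm.
Unshelve. all: by end_near. Qed.

Lemma cvg_innerr {T : Type} {F : set_system T} {FF : Filter F}
    (w : H) (u : T -> H) (l : H) :
  u @ F --> l -> '[w, u t] @[t --> F] --> '[w, l].
Proof.
move=> ul; apply/subr_cvg0.
have -> : (fun t => '[w, u t] - '[w, l]) = (fun t => '[u t - l, w]).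
  by apply/funext => t; rewrite !innerE (innerC w) (innerC w).
apply: (@cvg_inner_bounded0 _ _ _ _ (fun=> w) `|w|); first exact: nearW.
exact/subr_cvg0.
Qed.

End InnerProduct.

(** * Quadratic minimization, metric projections and Riesz representation *)

Section ClosedConvex.
Context {R : realType} {H : hilbertType R}.
Implicit Types (D : set H) (p q v : H).

(** Convexity in the form that the perturbation arguments below use: a step of
    length [t] from [p] towards [q]. *)
Lemma convex_setP D : convex_set D <->
  (forall p q (t : R), 0 <= t <= 1 -> D p -> D q -> D (p + t *: (q - p))).
Proof.
have convE p q (t : {i01 R}) :
    conv t (q : convex_lmodType H) p = p + t%:num *: (q - p).
  by rewrite /conv/= scalerBr scalerBl scale1r addrCA.
split=> [cD p q t t01 Dp Dq|cD q p t].
  have /andP[t0 t1] := t01.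
  have it : Itv.spec (@Itv.num_sem R) (Itv.Real `[0%Z, 1%Z]) t.
    by rewrite /= /Itv.num_sem/= in_itv/= t0 t1 num_real.
  have := cD q p (Itv.mk it); rewrite !inE => /(_ Dq Dp).
  by rewrite convE.
rewrite !inE => Dq Dp; rewrite convE; apply: cD => //.
by apply/andP; split.
Qed.

Lemma halfspaces_closed (I : Type) (P : set I) (c : I -> H) (b : I -> R) :
  closed [set q | forall i, P i -> '[c i, q] <= b i].
Proof.
have -> : [set q | forall i, P i -> '[c i, q] <= b i] =
    \bigcap_(i in P) (fun q => '[c i, q]) @^-1` [set r | r <= b i] by [].
apply: closed_bigI => i _; apply: closed_comp; last exact: closed_le.
by move=> q _; exact: cvg_innerr.
Qed.

Lemma halfspaces_convex (I : Type) (P : set I) (c : I -> H) (b : I -> R) :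
  convex_set [set q : H | forall i, P i -> '[c i, q] <= b i].
Proof.
apply/convex_setP => p q t /andP[t0 t1] Dp Dq i Pi.
have := Dp i Pi; have := Dq i Pi; rewrite !innerE => hq hp.
by nra.
Qed.

Lemma convex_setI D D' :
  convex_set D -> convex_set D' -> convex_set (D `&` D').
Proof.
move=> /convex_setP cD /convex_setP cD'; apply/convex_setP.
by move=> p q t t01 [? ?] [? ?]; split; [exact: cD|exact: cD'].
Qed.

(** By the parallelogram law, the values of |q|^2 - 2 l q at two points and at
    their midpoint control the distance of the points, so every minimizing
    sequence is Cauchy.  Taking l = <v, .> gives the nearest point to v; taking
    D to be the whole space gives the Riesz representative of l. *)
Lemma quadratic_min_exists D (l : H -> R) (M : R) :
    D !=set0 -> closed D -> convex_set D ->
    (forall (c : R) p q, l (c *: p + q) = c * l p + l q) ->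
    (forall p, `|l p| <= M * `|p|) ->
  exists p, D p /\ forall q, D q -> `|p| ^+ 2 - 2 * l p <= `|q| ^+ 2 - 2 * l q.
Proof.
move=> [d Dd] clD /convex_setP cD linl lM.
pose f q : R := `|q| ^+ 2 - 2 * l q.
have lB p q : l (p - q) = l p - l q.
  by rewrite addrC -scaleN1r linl mulN1r addrC.
have l2 p q : l (p + 2^-1 *: (q - p)) = (l p + l q) / 2.
  by rewrite addrC linl lB; lra.
pose E : set R := f @` D.
(* |q|^2 - 2 M |q| is minimal at |q| = M. *)
have E_lb : lbound E (- M ^+ 2).
  move=> _ [q _ <-]; rewrite /f.
  have := lM q; rewrite ler_norml => /andP[_ lq].
  by have := sqr_ge0 (`|q| - M); nra.
have E_inf : has_inf E by split; [exists (f d), d|exists (- M ^+ 2)].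
have E_le q : D q -> inf E <= f q.
  by move=> Dq; apply: ge_inf; [exists (- M ^+ 2)|exists q].
have /choice[x xP] : forall n : nat, exists p, D p /\ f p < inf E + n.+1%:R^-1.
  move=> n; have := inf_adherent (_ : 0 < n.+1%:R^-1 :> R) E_inf.
  by case=> [|_ [p Dp <-] ?]; [rewrite invr_gt0|exists p].
have x_cauchy n m : `|x n - x m| ^+ 2 <= 2 * (n.+1%:R^-1 + m.+1%:R^-1).
  have [Dn fn] := xP n; have [Dm fm] := xP m.
  have half01 : 0 <= (2^-1 : R) <= 1 by lra.
  have := E_le _ (cD (x n) (x m) 2^-1 half01 Dn Dm); rewrite /f l2.
  move: fn fm; rewrite /f !sqr_norm_inner !innerE (innerC (x m) (x n)).
  move: (n.+1%:R^-1) (m.+1%:R^-1) (inf E : R) => e1 e2 i.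
  by lra.
have /cvg_ex[p xp] : cvg (x @ \oo).
  apply/cauchy_cvgP/cauchy_ballP => e e0.
  have e2 : 0 < e ^+ 2 / 4 by rewrite divr_gt0// exprn_gt0.
  have near_e : \forall n \near \oo, n.+1%:R^-1 < e ^+ 2 / 4 :> R.
    have /cvgrPdist_lt/(_ _ e2) := @cvg_harmonic R; apply: filterS => n /=.
    by rewrite sub0r normrN ger0_norm ?invr_ge0.
  rewrite near_map2; near=> a b; rewrite -ball_normE/=.
  rewrite -(ltr_pXn2r (ltn0Sn 1)) ?nnegrE ?normr_ge0 ?(ltW e0)//.
  apply: le_lt_trans (x_cauchy a b) _.
  have ha : a.+1%:R^-1 < e ^+ 2 / 4 by near: a.
  have hb : b.+1%:R^-1 < e ^+ 2 / 4 by near: b.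
  by move: (a.+1%:R^-1) (b.+1%:R^-1) ha hb => ? ? ? ?; lra.
exists p; split.
  by apply: (closed_cvg _ clD _ _ xp); apply: nearW => n; have [] := xP n.
move=> q Dq; apply: le_trans (E_le _ Dq).
have l_cvg : l (x n) @[n --> \oo] --> l p.
  apply/subr_cvg0; apply/cvgr0Pnorm_lt => e e0.
  have M1 : 0 < `|M| + 1 by rewrite ltr_pwDr.
  have /cvgrPdist_lt/(_ _ (divr_gt0 e0 M1)) := xp.
  apply: filterS => n; rewrite distrC ltr_pdivlMr// -lB => h.
  apply: le_lt_trans (lM _) _; apply: le_lt_trans h.
  rewrite mulrC ler_wpM2l//; have := ler_norm M; lra.
have f_cvg : f (x n) @[n --> \oo] --> f p.
  apply: cvgB; last by apply: cvgMl_tmp.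
  by apply: cvgM; exact: cvg_norm.
have h_cvg : inf E + n.+1%:R^-1 @[n --> \oo] --> inf E.
  rewrite -[X in _ --> X]addr0; apply: cvgD; first exact: cvg_cst.
  exact: cvg_harmonic.
rewrite -/(f p) -(cvg_lim _ f_cvg)// -(cvg_lim _ h_cvg)//.
apply: ler_lim; [by apply/cvg_ex; exists (f p)|by apply/cvg_ex; exists (inf E)|].
by apply: nearW => n; have [_ /ltW] := xP n.
Unshelve. all: by end_near. Qed.

(** First-order optimality: the derivative of |q|^2 / 2 - l q at a minimizer [p] is
    nonnegative in every direction that points into D. *)
Lemma quadratic_min_variational D (l : H -> R) p :
    convex_set D -> (forall (c : R) p q, l (c *: p + q) = c * l p + l q) ->
    D p -> (forall q, D q -> `|p| ^+ 2 - 2 * l p <= `|q| ^+ 2 - 2 * l q) ->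
  forall q, D q -> l (q - p) <= '[p, q - p].
Proof.
move=> /convex_setP cD linl Dp minp q Dq.
rewrite leNgt; apply/negP => lt_e.
set e := l (q - p) - '[p, q - p].
have e_gt0 : 0 < e by rewrite subr_gt0.
have N_ge0 := inner_ge0 (q - p); set N := '[q - p, q - p] in N_ge0.
(* The quadratic has derivative - 2 e towards q, so a step of length t changes it
   by t (t N - 2 e), which is negative at t = e / (N + e) <= 1. *)
pose t := e / (N + e).
have Ne_gt0 : 0 < N + e by lra.
have t_gt0 : 0 < t by rewrite divr_gt0.
have tE : t * (N + e) = e by rewrite divfK// gt_eqF.
have t_le1 : t <= 1 by rewrite ler_pdivrMr//; lra.
have t01 : 0 <= t <= 1 by rewrite ltW.
have := minp _ (cD p q t t01 Dp Dq).
have -> : p + t *: (q - p) = t *: (q - p) + p by rewrite addrC.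
rewrite linl !sqr_norm_inner innerDl !innerDr !innerZl !innerZr.
rewrite (innerC (q - p) p) -/N.
rewrite [l (q - p)](_ : _ = e + '[p, q - p]); last by rewrite /e subrK.
move: '[p, p] '[p, q - p] => pp pqp.
by nra.
Qed.

Lemma riesz (l : H -> R) (M : R) :
    (forall (c : R) p q, l (c *: p + q) = c * l p + l q) ->
    (forall p, `|l p| <= M * `|p|) ->
  exists w, forall h, l h = '[w, h].
Proof.
move=> linl lM.
have cT : convex_set [set: H] by apply/convex_setP.
have [w [_ minw]] := quadratic_min_exists (ex_intro _ 0 I) closedT cT linl lM.
have var := quadratic_min_variational cT linl I minw.
exists w => h; apply/eqP; rewrite eq_le.
have := var (w + h) I; have := var (w - h) I.
rewrite ![w + _]addrC !addrK innerNr.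
have -> : l (- h) = - l h.
  have l0 : l 0 = 0 by have := linl (- 1) 0 0; rewrite scaler0 addr0 mulN1r addNr.
  by rewrite -[- h]addr0 -scaleN1r linl l0 addr0 mulN1r.
by rewrite lerN2 => -> ->.
Qed.

(** The minimal distance and the obtuse-angle inequality are the two descriptions
    of the projection; the second one is linear in [q], hence survives weak
    limits. *)
Lemma metric_projP D v : D !=set0 -> closed D -> convex_set D ->
  [/\ D (metric_proj D v),
      forall q, D q -> `|v - metric_proj D v| <= `|v - q| &
      forall q, D q -> '[v - metric_proj D v, q - metric_proj D v] <= 0].
Proof.
move=> D0 clD cD.
have linv (c : R) p q : '[v, c *: p + q] = c * '[v, p] + '[v, q].
  by rewrite innerDr innerZr.
have distE q : `|v - q| ^+ 2 = `|v| ^+ 2 + (`|q| ^+ 2 - 2 * '[v, q]).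
  by rewrite !sqr_norm_inner !innerE (innerC q v); ring.
have distP p q : (`|p| ^+ 2 - 2 * '[v, p] <= `|q| ^+ 2 - 2 * '[v, q]) =
    (`|v - p| <= `|v - q|).
  by rewrite -[RHS](ler_pXn2r (ltn0Sn 1)) ?nnegrE// !distE lerD2l.
have [p [Dp minp]] := quadratic_min_exists D0 clD cD linv (cauchy_schwarz v).
have [DP minP] : D (metric_proj D v) /\
    forall q, D q -> `|v - metric_proj D v| <= `|v - q|.
  rewrite /metric_proj; case: xgetP => [_ -> //|/(_ p)[]].
  by split=> // q Dq; rewrite -distP; exact: minp.
split=> // q Dq; rewrite innerDl innerNl subr_le0.
by apply: quadratic_min_variational cD linv DP _ q Dq => r Dr; rewrite distP minP.
Qed.

End ClosedConvex.

(** * Weak sequential compactness *)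

Lemma ultra_fmap (T U : Type) (f : T -> U) (F : set_system T) :
  UltraFilter F -> UltraFilter (f @ F).
Proof.
move=> FU; have FP := @ultra_proper _ _ FU.
split; first exact: fmap_proper_filter.
move=> G GF FG; rewrite predeqE => A; split=> [GA|]; last exact: FG.
have [//|FnAf] := in_ultra_setVsetC (f @^-1` A) FU.
have GnA : G (~` A) by apply: FG; rewrite /fmap/=.
by have /filter_ex [? []] : G (A `&` (~` A)) by exact: filterI.
Qed.

Section WeakCompactness.
Context {R : realType} {H : hilbertType R}.
Implicit Types (v : nat -> H) (w h : H).

Lemma cvg_selection {f : nat -> nat} :
  (forall k, (k <= f k)%N) -> f @ \oo --> \oo.
Proof.
move=> kf A [N _ NA]; exists N => // k /= Nk; apply: NA => /=.
exact: leq_trans (kf k).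
Qed.

(** Along an ultrafilter finer than [\oo], all the bounded real sequences
    <v_k, h> converge; the limit is a bounded linear functional of h, represented
    by w.  A selection f then makes <v_(f k) - w, v_m> tend to 0 for every m.
    The h with <v_(f k) - w, h> --> 0 form a closed subspace E that contains all
    v_m.  Its orthogonal complement is orthogonal to every v_m, and therefore to
    their weak limit w, so E is everything. *)
Lemma bounded_weak_subsequence v (B : R) : (forall k, `|v k| <= B) ->
  exists w (f : nat -> nat), (forall k, (k <= f k)%N) /\ weakly_cvg (v \o f) w.
Proof.
move=> vB.
have [U [UU sU]] := ultraFilterLemma (_ : ProperFilter \oo).
have UP : ProperFilter U := @ultra_proper _ _ UU.
have Binner k h : `|'[v k, h]| <= B * `|h|.
  by apply: le_trans (cauchy_schwarz _ _) _; rewrite ler_wpM2r.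
have /choice[l l_cvg] : forall h : H, exists l : R, '[v k, h] @[k --> U] --> l.
  move=> h; pose g k := '[v k, h].
  have : compact `[- (B * `|h|), B * `|h|] by exact: segment_compact.
  rewrite compact_ultra => /(_ (g @ U) (ultra_fmap g UU))[|l [_ gl]]; last first.
    by exists l.
  apply: (@filterE _ U) => k /=.
  by rewrite in_itv/= -ler_norml; exact: Binner.
have l_lin (c : R) p q : l (c *: p + q) = c * l p + l q.
  rewrite -(cvg_lim _ (l_cvg (c *: p + q)))//; apply: cvg_lim => //.
  under eq_fun do rewrite innerDr innerZr.
  by apply: cvgD => //; exact: cvgMl_tmp.
have l_bound h : `|l h| <= B * `|h|.
  apply: (closed_cvg _ (@closed_le _ (B * `|h|)) _ _ (cvg_norm (l_cvg h))).
  by apply: nearW => k; exact: Binner.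
have [w wE] := riesz l_lin l_bound.
have w_cvg h : '[v k - w, h] @[k --> U] --> (0 : R).
  under eq_fun do rewrite innerDl innerNl -wE.
  by apply/subr_cvg0.
have /choice[f fP] : forall n : nat, exists k : nat, (n <= k)%N /\
    forall m : 'I_n.+1, `|'[v k - w, v m]| < n.+1%:R^-1.
  move=> n; apply: (@filter_ex _ U); apply: filterI.
    by apply: sU; exact: nbhs_infty_ge.
  apply: filter_forall => m.
  have /cvgr0Pnorm_lt := w_cvg (v m); apply.
  by rewrite invr_gt0.
exists w, f; split=> [k|]; first by have [] := fP k.
pose E := [set h | '[v (f k) - w, h] @[k --> \oo] --> (0 : R)].
suff ET : forall h, E h.
  move=> h; apply/subr_cvg0; under eq_fun do rewrite -innerNl -innerDl.
  exact: ET.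
have E_lin (c : R) p q : E p -> E q -> E (c *: p + q).
  rewrite /E/= => Ep Eq; under eq_fun do rewrite innerDr innerZr.
  have cEp : c * '[v (f k) - w, p] @[k --> \oo] --> c * 0 by exact: cvgMl_tmp.
  have := cvgD cEp Eq; rewrite mulr0 addr0; exact.
have E_v m : E (v m).
  apply/cvgr0Pnorm_lt => e e0; near=> n.
  have mn : (m < n.+1)%N by near: n; exact: nbhs_infty_ge.
  have [_ /(_ (Ordinal mn)) small] := fP n; apply: lt_trans small _; near: n.
  have /cvgrPdist_lt/(_ _ e0) := @cvg_harmonic R; apply: filterS => n /=.
  by rewrite sub0r normrN ger0_norm ?invr_ge0.
have E0 : E !=set0 by exists (v 0).
have convE : convex_set E.
  apply/convex_setP => p q t _ Ep Eq; rewrite addrC.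
  by apply: (E_lin) => //; rewrite addrC -scaleN1r; exact: E_lin.
have clE : closed E.
  move=> h hE; apply/cvgr0Pnorm_lt => e e0.
  have B0 : 0 <= B := le_trans (normr_ge0 _) (vB 0).
  have M0 : 0 < B + `|w| + 1 by have := normr_ge0 w; lra.
  have [q [Eq]] := hE _ (nbhsx_ballx h _ (divr_gt0 e0 (mulr_gt0 (ltr0n _ 2) M0))).
  rewrite -ball_normE/= ltr_pdivlMr ?mulr_gt0// => hq.
  have /cvgr0Pnorm_lt/(_ _ (divr_gt0 e0 (ltr0n _ 2))) := Eq.
  apply: filterS => k hk.
  have -> : '[v (f k) - w, h] = '[v (f k) - w, h - q] + '[v (f k) - w, q].
    by rewrite -innerDr subrK.
  apply: le_lt_trans (ler_normD _ _) _.
  have := cauchy_schwarz (v (f k) - w) (h - q).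
  have : `|v (f k) - w| <= B + `|w|.
    by apply: le_trans (ler_normB _ _) _; rewrite lerD2r.
  move: hq hk (normr_ge0 (v (f k) - w)) (normr_ge0 (h - q)) (normr_ge0 w).
  move: `|v (f k) - w| `|h - q| `|w| `|'[_, q]| `|'[_, h - q]|.
  by move=> a b c i j *; nra.
move=> h; have [Eq _ var] := metric_projP h E0 clE convE.
set q := metric_proj E h in Eq var; set d := h - q in var.
have d_v m : '[d, v m] = 0.
  have Ep : E (v m + q) by rewrite -[v m]scale1r; exact: E_lin.
  have En : E (- v m + q) by rewrite -scaleN1r; exact: E_lin.
  have := var _ Ep; have := var _ En.
  by rewrite !addrK innerNr; lra.
have w_d : '[w, d] = 0.
  rewrite -wE -(cvg_lim _ (l_cvg d))//.
  by under eq_fun do rewrite innerC d_v; exact: lim_cst.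
rewrite /E/=.
suff -> : (fun k => '[v (f k) - w, h]) = (fun k => '[v (f k) - w, q]) by [].
apply/funext => k; rewrite -[h](subrK q) -/d innerDr.
by rewrite innerDl innerNl w_d (innerC _ d) d_v oppr0 !add0r.
Unshelve. all: by end_near. Qed.
End WeakCompactness.

(** * Weak limits *)

Section WeakLimits.
Context {R : realType} {H : hilbertType R}.
Implicit Types (v : nat -> H) (w h : H).

(** The half-space <w - P w, . - P w> <= 0 contains D, is weakly closed, and
    excludes w unless w is its own projection P w. *)
Lemma weakly_cvg_closed_convex (D : set H) v w :
  closed D -> convex_set D -> (forall k, D (v k)) -> weakly_cvg v w -> D w.
Proof.
move=> clD cD Dv vw.
have [DP _ var] := metric_projP w (ex_intro _ _ (Dv 0)) clD cD.
set P := metric_proj D w in DP var.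
suff -> : w = P by [].
apply/eqP; rewrite -subr_eq0 -normr_eq0 -sqrf_eq0 sqr_norm_inner.
rewrite eq_le inner_ge0 andbT.
have lim_P : '[v k - P, w - P] @[k --> \oo] --> '[w - P, w - P].
  by under eq_fun do rewrite innerDl; rewrite innerDl; apply: cvgD;
    [exact: vw|exact: cvg_cst].
apply: (closed_cvg _ (@closed_le _ 0) _ _ lim_P); apply: nearW => k /=.
by rewrite innerC; exact: var.
Qed.

Lemma weakly_cvg_sub0 v v' w :
  weakly_cvg v w -> (v' k - v k) @[k --> \oo] --> (0 : H) -> weakly_cvg v' w.
Proof.
move=> vw v'v h.
have -> : (fun k => '[v' k, h]) = (fun k => '[v' k - v k, h] + '[v k, h]).
  by apply/funext => k; rewrite -innerDl subrK.
rewrite -[X in _ --> X]add0r; apply: cvgD; last exact: vw.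
by under eq_fun do rewrite innerC; rewrite -(linear0r inner h); exact: cvg_innerr.
Qed.

End WeakLimits.

(** * Demicontractive maps *)

Section Demicontractive.
Context {R : realType} {H : hilbertType R}.
Implicit Types (T : H -> H) (p x z : H).

(** Expanding |T x - p|^2 around x turns demicontractivity into a condition that is
    affine in the fixed point p. *)
Lemma demicontractive_inner (lambda : R) T p x :
  demicontractive lambda T -> fixpoints T p ->
  (1 - lambda) / 2 * `|x - T x| ^+ 2 <= '[x - T x, x - p].
Proof.
move=> /(_ x p) /[apply].
rewrite !sqr_norm_inner !innerE.
rewrite (innerC p x) (innerC p (T x)) (innerC (T x) x).
by lra.
Qed.

(** A point [p] in all these half-spaces is fixed: take x = p.  So Fix(T) is closed
    and convex although T need not be continuous. *)
Lemma fixpoints_halfspaces (lambda : R) T :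
    lambda < 1 -> demicontractive lambda T ->
  fixpoints T = [set p | forall x, [set: H] x ->
    '[x - T x, p] <= '[x - T x, x] - (1 - lambda) / 2 * `|x - T x| ^+ 2].
Proof.
move=> lambda1 demT; apply/seteqP; split=> [p Tp x _|p hp].
  have := demicontractive_inner x demT Tp.
  by rewrite innerDr innerNr; lra.
have := hp p I; have lambda2 : 0 < (1 - lambda) / 2 by lra.
rewrite lerBrDl gerDr pmulr_rle0// => d_le0.
apply/esym/eqP; rewrite -subr_eq0 -normr_eq0 -sqrf_eq0.
by rewrite eq_le d_le0 sqr_ge0.
Qed.

Lemma relaxed_demicontractive (lambda t : R) T p z :
    demicontractive lambda T -> fixpoints T p -> 0 <= t ->
  `|z - t *: (z - T z) - p| ^+ 2 <=
  `|z - p| ^+ 2 - t * (1 - lambda - t) * `|z - T z| ^+ 2.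
Proof.
move=> demT Tp t0; have := demicontractive_inner z demT Tp.
have -> : z - t *: (z - T z) - p = (z - p) - t *: (z - T z).
  by rewrite addrAC.
move: (z - p) (z - T z) => e d h.
rewrite !sqr_norm_inner !innerDl !innerDr !innerNl !innerNr !innerZl !innerZr.
rewrite (innerC e d) -sqr_norm_inner -sqr_norm_inner.
by move: h; move: `|d| `|e| '[d, e] => a b c h; nra.
Qed.

End Demicontractive.

(** * Monotone variational inequalities *)

Section VariationalInequality.
Context {R : realType} {H : hilbertType R}.
Context (C : set H) (A : H -> H) (L : R).
Context (C_closed : closed C) (C_convex : convex_set C).
Context (A_mono : monotone_map A) (L_gt0 : 0 < L).
Context (A_lip : forall x y, `|A x - A y| <= L * `|x - y|).

(** Minty's lemma: moving A from the solution [p] to the test point [x] makes the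
    inequality affine in [p], hence stable under weak limits.  Monotonicity gives
    one inclusion; for the other, test at p + t (x - p) and let t go to 0. *)
Lemma VI_minty : VI C A = C `&` [set p | forall x, C x -> '[A x, p] <= '[A x, x]].
Proof.
apply/seteqP; split=> p [Cp hp]; split=> // x Cx.
  have := A_mono x p; have := hp x Cx.
  by rewrite !innerE; lra.
rewrite leNgt; apply/negP => lt0.
have N_ge0 := inner_ge0 (x - p).
have mono_t (t : R) : 0 < t <= 1 -> 0 <= '[A p, x - p] + t * L * `|x - p| ^+ 2.
  move=> /andP[t0 t1].
  have t01 : 0 <= t <= 1 by rewrite ltW.
  have := hp _ ((convex_setP C).1 C_convex p x t t01 Cp Cx).
  set xt := p + t *: (x - p).
  rewrite -subr_le0 -innerNr -innerDr /xt opprD addrA subrr add0r -/xt.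
  rewrite innerNr innerZr oppr_le0 pmulr_rge0// => xt_ge0.
  apply: le_trans xt_ge0 _.
  rewrite -lerBlDl -innerNl -innerDl; apply: le_trans (inner_le_norm _ _) _.
  rewrite expr2 mulrA ler_wpM2r//.
  apply: le_trans (A_lip _ _) _.
  by rewrite /xt addrAC subrr add0r normrZ (gtr0_norm t0) mulrA (mulrC L).
set e := - '[A p, x - p]; have e0 : 0 < e by rewrite oppr_gt0.
rewrite sqr_norm_inner in mono_t; set N := '[x - p, x - p] in N_ge0 mono_t.
have LN : 0 <= L * N by rewrite mulr_ge0// ltW.
have LNe : 0 < L * N + e by lra.
(* A step so short that the Lipschitz error t L N stays below e. *)
pose t := e / (L * N + e).
have t_gt0 : 0 < t by rewrite divr_gt0.
have tE : t * (L * N + e) = e by rewrite divfK// gt_eqF.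
have t_le1 : t <= 1 by rewrite ler_pdivrMr//; lra.
have t01 : 0 < t <= 1 by rewrite t_gt0.
have := mono_t t t01.
have -> : '[A p, x - p] = - e by rewrite opprK.
have te0 : 0 < t * e by rewrite mulr_gt0.
by nra.
Qed.

(** The half-space in the definition of [z] contains C, hence [p], so the
    obtuse-angle inequality of the second projection may be tested at [p].
    Monotonicity makes the term with [A y] and [p] favourable, and what remains is
    the inner product of A s - A y and z - y, which the step-size condition
    bounds. *)
Lemma extragradient_step (gamma kappa : R) (p s y z : H) :
    0 < gamma -> VI C A p ->
    y = metric_proj C (s - gamma *: A s) ->
    z = metric_proj [set w | '[s - gamma *: A s - y, w - y] <= 0]
          (s - gamma *: A y) ->
    gamma * `|A s - A y| <= kappa * `|s - y| ->
    0 <= kappa ->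
  `|z - p| ^+ 2 <=
    `|s - p| ^+ 2 - (1 - kappa) * (`|s - y| ^+ 2 + `|z - y| ^+ 2).
Proof.
move=> gamma0 [Cp VIp] yE zE lipk kappa0.
have [Cy _ y_var] := metric_projP (s - gamma *: A s) (ex_intro _ _ Cp)
  C_closed C_convex.
rewrite -yE in Cy y_var.
set Hk := [set w | _] in zE.
have HkE : Hk = [set w | forall i : unit, [set: unit] i ->
    '[s - gamma *: A s - y, w] <= '[s - gamma *: A s - y, y]].
  apply/seteqP; split=> w; rewrite /Hk/= innerDr innerNr.
    by move=> h _ _; lra.
  by move/(_ tt I); lra.
have Hky : Hk y by rewrite /Hk/= subrr (linear0r inner).
have Hkcl : closed Hk by rewrite HkE; exact: halfspaces_closed.
have Hkcv : convex_set Hk by rewrite HkE; exact: halfspaces_convex.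
have [Hkz _ z_var] := metric_projP (s - gamma *: A y) (ex_intro _ _ Hky) Hkcl Hkcv.
rewrite -zE in Hkz z_var.
have p_var := z_var p (y_var p Cp).
have VI_y : 0 <= '[A y, y - p].
  by have := A_mono y p; have := VIp y Cy; rewrite !innerE; lra.
have cross : gamma * '[A s - A y, z - y] <= kappa * (`|s - y| * `|z - y|).
  rewrite -innerZl; apply: le_trans (inner_le_norm _ _) _.
  by rewrite normrZ (gtr0_norm gamma0) mulrA ler_wpM2r.
have amgm : 2 * (`|s - y| * `|z - y|) <= `|s - y| ^+ 2 + `|z - y| ^+ 2.
  by have := sqr_ge0 (`|s - y| - `|z - y|); lra.
have {cross amgm} cross : 2 * gamma * '[A s - A y, z - y] <=
    kappa * (`|s - y| ^+ 2 + `|z - y| ^+ 2) by nra.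
(* Each of the last three terms is nonpositive, by [z] in the half-space, by
   [p_var] and by [VI_y] respectively. *)
suff id : `|z - p| ^+ 2 = `|s - p| ^+ 2 - (`|s - y| ^+ 2 + `|z - y| ^+ 2)
    + 2 * gamma * '[A s - A y, z - y]
    + 2 * '[s - gamma *: A s - y, z - y]
    + 2 * '[s - gamma *: A y - z, p - z]
    - 2 * (gamma * '[A y, y - p]).
  rewrite /Hk/= in Hkz.
  by rewrite id; have := mulr_ge0 (ltW gamma0) VI_y; lra.
rewrite !sqr_norm_inner !innerDl !innerDr !innerNl !innerNr !innerZl.
rewrite (innerC p z) (innerC p s) (innerC y s) (innerC y z).
by ring.
Qed.

(** By the projection inequality and monotonicity, <A x, y_k> exceeds <A x, x> by
    at most a constant times |s_k - y_k|; Minty's form passes to the limit. *)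
Lemma VI_weak_limit (m B : R) (gamma : nat -> R) (s y : nat -> H) w :
    0 < m -> (forall k, m <= gamma k) -> C !=set0 ->
    (forall k, y k = metric_proj C (s k - gamma k *: A (s k))) ->
    (\forall k \near \oo, `|y k| <= B) ->
    (s k - y k) @[k --> \oo] --> (0 : H) -> weakly_cvg y w ->
  VI C A w.
Proof.
move=> m0 mgamma C0 yE yB sy yw.
have yP k := metric_projP (s k - gamma k *: A (s k)) C0 C_closed C_convex.
rewrite VI_minty; split.
  apply: weakly_cvg_closed_convex C_closed C_convex _ yw => k.
  by rewrite yE; have [] := yP k.
move=> x Cx; rewrite innerC.
pose c := (m^-1 + L) * (B + `|x|).
suff bound k : `|y k| <= B -> '[y k, A x] <= '[A x, x] + c * `|s k - y k|.
  have lim_r : '[A x, x] + c * `|s k - y k| @[k --> \oo] --> '[A x, x].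
    rewrite -[X in _ --> X]addr0 -[X in _ --> _ + X](mulr0 c).
    apply: cvgD; first exact: cvg_cst.
    by apply: cvgMl_tmp; rewrite -(@normr0 _ H); exact: cvg_norm.
  rewrite -(cvg_lim _ (yw (A x)))// -(cvg_lim _ lim_r)//.
  by apply: ler_lim; [apply: cvgP (yw _)|apply: cvgP lim_r|exact: filterS yB].
move=> ykB; have [_ _] := yP k; rewrite -yE => /(_ x Cx).
have gk : 0 < gamma k := lt_le_trans m0 (mgamma k).
have mono := A_mono x (y k).
have xy_le : `|x - y k| <= B + `|x|.
  by apply: le_trans (ler_normB _ _) _; rewrite addrC lerD2r.
have lip : - (L * (`|s k - y k| * `|x - y k|)) <= '[A (y k) - A (s k), x - y k].
  apply: le_trans (inner_ge_norm _ _).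
  rewrite lerN2 mulrA ler_wpM2r//.
  by apply: le_trans (A_lip _ _) _; rewrite distrC.
have cs := inner_ge_norm (s k - y k) (x - y k).
rewrite addrAC innerDl innerNl innerZl => var.
have low : - (m^-1 * (`|s k - y k| * `|x - y k|)) <= '[A (s k), x - y k].
  rewrite -(ler_pM2l gk); apply: le_trans (_ : '[s k - y k, x - y k] <= _); last first.
    by lra.
  apply: le_trans cs; rewrite mulrN lerN2 mulrA ler_peMl ?mulr_ge0//.
  by rewrite ler_pdivlMr// mul1r.
have prod_le : `|s k - y k| * `|x - y k| <= `|s k - y k| * (B + `|x|).
  by rewrite ler_wpM2l.
have cE : c * `|s k - y k| = (m^-1 + L) * (`|s k - y k| * (B + `|x|)).
  by rewrite /c; ring.
have cL : (m^-1 + L) * (`|s k - y k| * `|x - y k|) <= c * `|s k - y k|.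
  by rewrite cE ler_wpM2l// addr_ge0// ?invr_ge0 ltW.
move: mono lip low cL; rewrite mulrDl !innerDl !innerNl.
rewrite [_ (A x) (x - y k)]innerDr innerNr (innerC (y k)).
by lra.
Qed.

End VariationalInequality.

(** * Real recursions and step sizes *)

Section RealSequences.
Context {R : realType}.
Implicit Types (a b g beta gamma : nat -> R).

Lemma divergent_tails beta :
    (forall k, (1 <= k)%N -> 0 <= beta k) ->
    (\sum_(1 <= k <oo) (beta k)%:E)%E = +oo%E ->
  forall (M : R) N, (1 <= N)%N ->
    exists n, (N <= n)%N /\ M < \sum_(N <= k < n) beta k.
Proof.
move=> beta0 sum_oo M N N1; apply: contrapT => nex.
have tail_le n : (N <= n)%N -> \sum_(N <= k < n) beta k <= M.
  by move=> Nn; rewrite leNgt; apply/negP => lt; apply: nex; exists n.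
suff : (\sum_(1 <= k <oo) (beta k)%:E <= (\sum_(1 <= k < N) beta k + M)%:E)%E.
  by rewrite sum_oo leNgt ltry.
apply: lime_le.
  by apply: is_cvg_nneseries => k k1 _; rewrite lee_fin beta0.
near=> n; rewrite sumEFin lee_fin.
have Nn : (N <= n)%N by near: n; exact: nbhs_infty_ge.
by rewrite (big_cat_nat N1 Nn)/= lerD2l tail_le.
Unshelve. all: by end_near. Qed.

(** While a_k > 2 e, the recursion lowers a_k by at least e beta_k, which the
    divergence of the sum allows only finitely often; and the bound 2 e, once
    reached, is kept. *)
Lemma recursion_eventually_le a beta (e : R) N :
    0 < e -> (forall k, (N <= k)%N -> 0 <= beta k <= 1) ->
    (forall k, (N <= k)%N -> a k.+1 <= (1 - beta k) * a k + beta k * e) ->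
    (forall (M : R) n0, (N <= n0)%N ->
      exists n, (n0 <= n)%N /\ M < \sum_(n0 <= k < n) beta k) ->
  exists n0, forall k, (n0 <= k)%N -> a k <= 2 * e.
Proof.
move=> e0 beta01 rec div.
have [[n0 [Nn0 an0]]|nex] := pselect (exists n0, (N <= n0)%N /\ a n0 <= 2 * e).
  exists n0; elim=> [|k ih]; first by rewrite leqn0 => /eqP n00; rewrite n00 in an0.
  rewrite leq_eqVlt => /predU1P[<-//|]; rewrite ltnS => n0k.
  have Nk := leq_trans Nn0 n0k.
  have := rec k Nk; have := ih n0k; have /andP[] := beta01 k Nk.
  by move: (beta k) (a k) (a k.+1) => b x y *; nra.
have gt2e k : (N <= k)%N -> 2 * e < a k.
  by move=> Nk; rewrite ltNge; apply/negP => le; apply: nex; exists k.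
have dec n : (N <= n)%N -> e * \sum_(N <= k < n) beta k <= a N - a n.
  elim: n => [|n ih].
    by rewrite leqn0 => /eqP ->; rewrite big_geq// mulr0 subrr.
  rewrite leq_eqVlt => /predU1P[<-|]; first by rewrite big_geq// mulr0 subrr.
  rewrite ltnS => Nn; rewrite big_nat_recr//= mulrDr.
  have := ih Nn; have := rec n Nn; have := gt2e n Nn.
  have /andP[] := beta01 n Nn.
  by move: (beta n) (a n) (a n.+1) (\sum_(_ <= k < _) _) => *; nra.
have [n [Nn]] := div (a N / e) N (leqnn N); rewrite ltr_pdivrMr// mulrC => lt.
by have := dec n Nn; have := gt2e n Nn; lra.
Qed.

(** When g_k is at least r, it outweighs beta_k B for large k; when it is smaller,
    b_k <= e.  Either way a_(k+1) <= (1 - beta_k) a_k + beta_k e eventually. *)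
Lemma recursion_cvg0 a b g beta (B : R) N :
    (forall k, (N <= k)%N -> 0 <= a k) ->
    (forall k, (N <= k)%N -> 0 <= beta k <= 1) ->
    (forall k, (N <= k)%N -> 0 <= g k) ->
    (forall k, (N <= k)%N -> b k <= B) ->
    (forall k, (N <= k)%N ->
      a k.+1 <= (1 - beta k) * a k + beta k * b k - g k) ->
    beta @ \oo --> (0 : R) ->
    (forall (M : R) n0, (N <= n0)%N ->
      exists n, (n0 <= n)%N /\ M < \sum_(n0 <= k < n) beta k) ->
    (forall e, 0 < e -> exists2 r, 0 < r &
      exists n0, forall k, (n0 <= k)%N -> g k < r -> b k <= e) ->
  a @ \oo --> (0 : R).
Proof.
move=> a0 beta01 g0 bB rec beta_cvg div small.
apply/cvgr0Pnorm_le => e e0.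
have e2 : 0 < e / 2 by rewrite divr_gt0.
have [r r0 [n1 n1P]] := small _ e2.
have B1 : 0 < `|B| + 1 by rewrite ltr_pwDr.
have /cvgr0Pnorm_lt/(_ _ (divr_gt0 r0 B1))[n2 _ n2P] := beta_cvg.
pose n := maxn N (maxn n1 n2).
have nP k : (n <= k)%N -> [/\ (N <= k)%N, (n1 <= k)%N & (n2 <= k)%N].
  by rewrite !geq_max => /andP[-> /andP[-> ->]].
have [|||n0 n0P] := @recursion_eventually_le a beta (e / 2) n e2.
- by move=> k /nP[Nk _ _]; exact: beta01.
- move=> k /nP[Nk n1k n2k]; have /andP[b0 b1] := beta01 k Nk.
  apply: le_trans (rec k Nk) _.
  have [gr|rg] := ltP (g k) r.
    rewrite -addrA lerD2l lerBlDr; apply: le_trans (_ : beta k * (e / 2) <= _).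
      by rewrite ler_wpM2l// n1P.
    by rewrite lerDl g0.
  rewrite -addrA lerD2l; apply: le_trans (_ : 0 <= _); last by rewrite mulr_ge0// ltW.
  rewrite subr_le0; apply: le_trans rg.
  apply: le_trans (_ : beta k * (`|B| + 1) <= _).
    rewrite ler_wpM2l//; apply: le_trans (bB k Nk) _.
    by have := ler_norm B; lra.
  rewrite -ler_pdivlMr//; apply: ltW.
  by apply: le_lt_trans (n2P k n2k); exact: ler_norm.
- by move=> M n0 nn0; apply: div; have [] := nP _ nn0.
near=> k.
have Nk : (N <= k)%N by near: k; exact: nbhs_infty_ge.
rewrite ger0_norm ?a0//.
have -> : e = 2 * (e / 2) by rewrite mulrC divfK// pnatr_eq0.
by apply: n0P; near: k; exact: nbhs_infty_ge.
Unshelve. all: by end_near. Qed.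

(** The step sizes decrease and stay above min(phi / L, gamma_1), since
    e_k / d_k >= 1 / L.  Their limit is therefore positive, which is what makes
    the quotient of consecutive terms tend to 1. *)
Lemma adaptive_stepsize gamma (L phi : R) (d e : nat -> R) :
    0 < L -> 0 < phi -> 0 < gamma 1%N ->
    (forall k, (1 <= k)%N -> 0 <= d k <= L * e k) ->
    (forall k, (1 <= k)%N -> gamma k.+1 =
      if d k != 0 then Num.min (phi * e k / d k) (gamma k) else gamma k) ->
  [/\ exists2 m, 0 < m & forall k, (1 <= k)%N -> m <= gamma k,
      forall k, (1 <= k)%N -> gamma k.+1 * d k <= phi * e k &
      gamma k / gamma k.+1 @[k --> \oo] --> (1 : R)].
Proof.
move=> L0 phi0 gamma1 dL gammaE.
have e_ge0 k : (1 <= k)%N -> 0 <= e k.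
  by move=> k1; have /andP[h1 h2] := dL k k1; rewrite -(pmulr_rge0 _ L0) (le_trans h1).
pose m := Num.min (phi / L) (gamma 1%N).
have m0 : 0 < m by rewrite lt_min divr_gt0.
have gamma_m k : (1 <= k)%N -> m <= gamma k.
  elim: k => // -[_ _|k ih _]; first by rewrite ge_min lexx orbT.
  rewrite gammaE//; case: ifPn => [d0|_]; last exact: ih.
  rewrite le_min ih// andbT ge_min; apply/orP; left.
  have /andP[h1 h2] := dL k.+1 isT.
  have dk : 0 < d k.+1 by rewrite lt_def d0.
  by rewrite -mulrA ler_pM2l// ler_pdivlMr// ler_pdivrMl.
have gamma_dec k : (1 <= k)%N -> gamma k.+1 <= gamma k.
  by move=> k1; rewrite gammaE//; case: ifP => // _; rewrite ge_min lexx orbT.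
split; first by exists m.
  move=> k k1; have /andP[h1 h2] := dL k k1.
  rewrite gammaE//; case: ifPn => [d0|]; last first.
    by rewrite negbK => /eqP ->; rewrite mulr0 mulr_ge0// ?e_ge0// ltW.
  have dk : 0 < d k by rewrite lt_def d0.
  by rewrite -ler_pdivlMr// ge_min lexx.
pose u k := gamma k.+1.
have u_dec : nonincreasing_seq u.
  by apply/nonincreasing_seqP => k; exact: gamma_dec.
have u_lb : has_lbound (range u).
  by exists m => _ [k _ <-]; exact: gamma_m.
have /cvg_ex[l ul] := nonincreasing_is_cvgn u_dec u_lb.
have l0 : 0 < l.
  apply: lt_le_trans m0 _.
  by apply: (closed_cvg _ (@closed_ge _ m) _ _ ul); apply: nearW => k; exact: gamma_m.
rewrite -cvg_shiftS -(divff (lt0r_neq0 l0)).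
apply: cvgM => //; apply: cvgV; first exact: lt0r_neq0.
by have := ul; rewrite -(cvg_shiftS u).
Qed.

End RealSequences.

(** * Halpern iteration with anchor 0 *)

Section Halpern.
Context {R : realType} {H : hilbertType R}.

(** Convergence of a perturbed Halpern iteration to the point [u] of [S] nearest
    to 0, in terms of a residual [D]: it suffices that the steps from [s] to [V]
    approach [u] with gain [D], and that weak cluster points along
    which [D] vanishes lie in [S].  The anchor contributes the term
    - 2 beta_k <u, x_(k+1) - u> to |x_(k+1) - u|^2, and its sign at such a cluster
    point is given by the obtuse-angle inequality at [u]. *)
Lemma halpern_convergence (x s V : nat -> H) (D beta zeta : nat -> R)
    (S : set H) (u : H) (K : nat) :
    (forall q, S q -> 0 <= '[u, q - u]) ->
    (forall k, (K <= k)%N -> 0 < beta k < 1) ->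
    (forall k, (K <= k)%N -> x k.+1 = (1 - beta k) *: V k) ->
    (forall k, (K <= k)%N -> `|s k - x k| <= zeta k) ->
    (forall k, (K <= k)%N -> 0 <= D k) ->
    (forall k, (K <= k)%N -> `|V k - u| ^+ 2 <= `|s k - u| ^+ 2 - D k) ->
    beta @ \oo --> (0 : R) ->
    zeta k / beta k @[k --> \oo] --> (0 : R) ->
    (forall (M : R) n0, (K <= n0)%N ->
      exists n, (n0 <= n)%N /\ M < \sum_(n0 <= k < n) beta k) ->
    (forall (f : nat -> nat) w (B : R),
      (forall k, (K <= f k)%N /\ (k <= f k)%N) ->
      (forall k, `|x (f k).+1| <= B) ->
      D (f k) @[k --> \oo] --> (0 : R) ->
      weakly_cvg (fun k => x (f k).+1) w -> S w) ->
  x k @[k --> \oo] --> u.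
Proof.
move=> uS beta01 xE sx D0 VD beta_cvg zeta_cvg div clust.
have [N [KN NP]] : exists N, (K <= N)%N /\
    forall k, (N <= k)%N -> zeta k <= beta k /\ beta k <= 2^-1.
  have half0 : 0 < 2^-1 :> R by [].
  have /cvgr0Pnorm_le/(_ _ half0)[n1 _ n1P] := beta_cvg.
  have /cvgr0Pnorm_le/(_ _ ltr01)[n2 _ n2P] := zeta_cvg.
  exists (maxn K (maxn n1 n2)); split=> [|k]; first exact: leq_maxl.
  rewrite !geq_max => /andP[/beta01 /andP[b0 _] /andP[k1 k2]]; split.
    have := le_trans (ler_norm _) (n2P k k2).
    by rewrite ler_pdivrMr// mul1r.
  exact: le_trans (ler_norm _) (n1P k k1).
have KP k : (N <= k)%N -> (K <= k)%N by exact: leq_trans KN.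
have zeta0 k : (N <= k)%N -> 0 <= zeta k.
  by move=> /KP Kk; exact: le_trans (sx k Kk).
have Vs k : (N <= k)%N -> `|V k - u| <= `|x k - u| + zeta k.
  move=> /KP Kk; apply: le_trans (_ : `|s k - u| <= _).
    rewrite -(ler_pXn2r (ltn0Sn 1)) ?nnegrE//.
    by apply: le_trans (VD k Kk) _; rewrite gerBl D0.
  have -> : s k - u = (x k - u) + (s k - x k).
    by rewrite [RHS]addrC addrA subrK.
  by apply: le_trans (ler_normD _ _) _; rewrite lerD2l sx.
have stepE k : (N <= k)%N ->
    x k.+1 - u = (1 - beta k) *: (V k - u) - beta k *: u.
  move=> /KP Kk; rewrite xE// scalerBr [(1 - beta k) *: u]scalerBl scale1r.
  by rewrite opprD opprK addrA addrK.
(* |x_(k+1) - u| is at most the convex combination of |x_k - u| and |u| + 1 with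
   weights 1 - beta_k and beta_k. *)
pose M := Num.max `|x N - u| (`|u| + 1).
have M_ge : `|u| + 1 <= M by rewrite le_max lexx orbT.
have x_bound k : (N <= k)%N -> `|x k - u| <= M.
  elim: k => [|k ih]; first by rewrite leqn0 => /eqP N0; rewrite /M N0 le_max lexx.
  rewrite leq_eqVlt => /predU1P[<-|]; first by rewrite le_max lexx.
  rewrite ltnS => Nk; rewrite stepE//.
  apply: le_trans (ler_normB _ _) _.
  have /andP[b0 b1] := beta01 k (KP k Nk).
  have [zb _] := NP k Nk.
  rewrite !normrZ (gtr0_norm b0) gtr0_norm ?subr_gt0//.
  have := Vs k Nk; have := ih Nk; have := zeta0 k Nk; have := normr_ge0 (V k - u).
  move: M_ge b0 b1 zb.
  move: (beta k) (zeta k) `|u| `|V k - u| `|x k - u| (M) => bk z nu v y m *.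
  by nra.
pose a k := `|x k - u| ^+ 2.
pose b k := zeta k / beta k * (2 * M + 1) - 2 * '[u, x k.+1 - u].
suff a_cvg : a @ \oo --> (0 : R).
  apply/subr_cvg0/cvgr0Pnorm_lt => e e0.
  have /cvgr0Pnorm_lt/(_ _ (exprn_gt0 2 e0)) := a_cvg.
  apply: filterS => k; rewrite /a ger0_norm ?sqr_ge0// => ak.
  by rewrite -(ltr_pXn2r (ltn0Sn 1)) ?nnegrE// ltW.
apply: (@recursion_cvg0 R a b (fun k => D k / 2) beta
  (2 * M + 1 + 2 * (`|u| * M)) N) => //.
- by move=> k _; exact: sqr_ge0.
- by move=> k /KP/beta01/andP[b0 b1]; rewrite !ltW.
- by move=> k /KP Kk; rewrite divr_ge0// D0.
- move=> k Nk; have [zb _] := NP k Nk.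
  have /andP[b0 _] := beta01 k (KP k Nk).
  have M0 : 0 <= 2 * M + 1 by have := normr_ge0 u; lra.
  apply: lerD.
    by rewrite -[leRHS]mul1r ler_wpM2r// ler_pdivrMr// mul1r.
  rewrite -mulrN ler_wpM2l// lerNl; apply: le_trans (inner_ge_norm _ _).
  by rewrite lerN2 ler_wpM2l// x_bound// leqW.
- move=> k Nk; have [zb b2] := NP k Nk.
  have /andP[b0 b1] := beta01 k (KP k Nk).
  have zE : beta k * (zeta k / beta k * (2 * M + 1)) = zeta k * (2 * M + 1).
    by rewrite mulrA mulrCA divff ?mulr1// gt_eqF.
  rewrite /b mulrBr zE /a.
  (* |p - c u|^2 = |p|^2 - 2 c <u, p - c u> - c^2 |u|^2. *)
  have normE : `|x k.+1 - u| ^+ 2 = (1 - beta k) ^+ 2 * `|V k - u| ^+ 2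
      - beta k * (2 * '[u, x k.+1 - u]) - beta k ^+ 2 * `|u| ^+ 2.
    by rewrite stepE// !sqr_norm_inner !innerE (innerC (V k) u); ring.
  rewrite normE.
  have sM : `|s k - u| <= `|x k - u| + zeta k.
    have -> : s k - u = (x k - u) + (s k - x k).
      by rewrite [RHS]addrC addrA subrK.
    by apply: le_trans (ler_normD _ _) _; rewrite lerD2l sx// KP.
  have s2 : `|s k - u| ^+ 2 <= `|x k - u| ^+ 2 + zeta k * (2 * M + 1).
    have := x_bound k Nk; have := zeta0 k Nk.
    have := normr_ge0 (s k - u); have := normr_ge0 (x k - u).
    move: sM zb b2.
    move: (beta k) (zeta k) `|s k - u| `|x k - u| (M) => bk z v y m *.
    have z1 : z <= 1 by lra.
    have : v ^+ 2 <= (y + z) ^+ 2 by rewrite ler_pXn2r// nnegrE addr_ge0.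
    by nra.
  have M0 : 0 <= zeta k * (2 * M + 1).
    by rewrite mulr_ge0 ?zeta0//; have := normr_ge0 u; lra.
  have := VD k (KP k Nk); have := D0 k (KP k Nk).
  have := sqr_ge0 (beta k * `|u|); have := sqr_ge0 `|V k - u|.
  move: s2 M0 b0 b1 b2; rewrite exprMn.
  move: (`|s k - u| ^+ 2) (`|x k - u| ^+ 2) (`|V k - u| ^+ 2) (D k)
    (zeta k * _) (beta k) (beta k ^+ 2 * _) => s' x' v' d z bk bu.
  move=> h1 h2 h3 h4 h5 h6 h7 h8 h9.
  have : (1 - bk) ^+ 2 * v' <= (1 - bk) * v'.
    by rewrite ler_wpM2r// expr2 ler_piMl; lra.
  have : (1 - bk) * v' <= (1 - bk) * (x' + z - d).
    by rewrite ler_wpM2l; lra.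
  have : 0 <= bk * z by rewrite mulr_ge0// ltW.
  have : 0 <= (2^-1 - bk) * d by rewrite mulr_ge0//; lra.
  by lra.
- by move=> M' n0 /KP; exact: div.
(* Otherwise D_k --> 0 and b_k > e along some f, which a weak cluster point of
   x_(k+1) along f contradicts. *)
move=> e e0; apply: contrapT => nsmall.
have /choice[f fP] : forall n : nat, exists k : nat,
    [/\ (N + n <= k)%N, D k / 2 < n.+1%:R^-1 & e < b k].
  move=> n; apply: contrapT => nex; apply: nsmall.
  exists n.+1%:R^-1; first by rewrite invr_gt0.
  exists (N + n)%N => k Nnk Dk; rewrite leNgt; apply/negP => ltb.
  by apply: nex; exists k.
have fN k : (N <= f k)%N by have [h _ _] := fP k; apply: leq_trans h; exact: leq_addr.
have fk k : (k <= f k)%N by have [h _ _] := fP k; apply: leq_trans h; exact: leq_addl.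
have xf_bound k : `|x (f k).+1| <= M + `|u|.
  rewrite -[x _](subrK u); apply: le_trans (ler_normD _ _) _.
  by rewrite lerD2r x_bound// leqW.
have [w [h [hk hw]]] := bounded_weak_subsequence xf_bound.
have Df_cvg : D (f k) @[k --> \oo] --> (0 : R).
  apply: (@squeeze_cvgr _ _ _ _ (fun=> 0) (fun k => 2 * k.+1%:R^-1)).
  - apply: nearW => k; rewrite D0 ?KP ?fN//=.
    have [_ Dk _] := fP k; apply: ltW; move: Dk.
    by move: (k.+1%:R^-1) => r; lra.
  - exact: cvg_cst.
  - rewrite -[X in _ --> X](mulr0 2); apply: cvgMl_tmp; exact: cvg_harmonic.
have Sw : S w.
  apply: (clust (f \o h) w (M + `|u|)) => //.
  - by move=> k; split; [apply: KP; exact: fN|exact: leq_trans (hk k) (fk _)].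
  - by move=> k; exact: xf_bound.
  - exact: cvg_comp (cvg_selection hk) Df_cvg.
have b_cvg : b (f (h k)) @[k --> \oo] --> 0 * (2 * M + 1) - 2 * '[u, w - u].
  have fh : (fun k => f (h k)) @ \oo --> \oo.
    by apply: cvg_selection => k; exact: leq_trans (hk k) (fk _).
  apply: cvgB.
    by apply: cvgMr_tmp; exact: cvg_comp fh zeta_cvg.
  apply: cvgMl_tmp; under eq_fun do rewrite innerDr innerNr innerC.
  rewrite innerDr innerNr innerC; apply: cvgB; [exact: hw|exact: cvg_cst].
have : e <= 0 * (2 * M + 1) - 2 * '[u, w - u].
  apply: (closed_cvg _ (@closed_ge _ e) _ _ b_cvg); apply: nearW => k /=.
  by have [_ _ /ltW] := fP (h k).
by have := uS w Sw; lra.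
Unshelve. all: by end_near. Qed.

End Halpern.

(** * Parameters and residuals of the algorithm *)

Section NullSequences.
Context {R : realType} {H : hilbertType R}.

Lemma norm_cvg0P (v : nat -> H) :
  v @ \oo --> (0 : H) <-> `|v k| @[k --> \oo] --> (0 : R).
Proof.
split=> [v0|v0]; first by rewrite -(@normr0 _ H); exact: cvg_norm.
by apply/cvgr0Pnorm_lt => e e0; have /cvgr0Pnorm_lt/(_ _ e0) := v0;
  apply: filterS => k; rewrite normr_id.
Qed.

Lemma cvg0_sqr_le (c : R) (v : nat -> H) (D : nat -> R) :
  0 < c -> (forall k, c * `|v k| ^+ 2 <= D k) ->
  D @ \oo --> (0 : R) -> v @ \oo --> (0 : H).
Proof.
move=> c0 vD D0; apply/cvgr0Pnorm_lt => e e0.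
have /cvgr0Pnorm_lt/(_ _ (mulr_gt0 c0 (exprn_gt0 2 e0))) := D0.
apply: filterS => k Dk.
rewrite -(ltr_pXn2r (ltn0Sn 1)) ?nnegrE ?normr_ge0 ?(ltW e0)//.
rewrite -(ltr_pM2l c0); apply: le_lt_trans (vD k) _.
exact: le_lt_trans (ler_norm _) Dk.
Qed.

End NullSequences.

Section RelaxationParameters.
Context {R : realType}.

(** The identity (1 - beta) (1 - lambda - t) =
    ((1 - lambda) theta - eta (lambda + theta)) + eta lambda theta shows that the
    bound on eta leaves the gap a lambda theta below the threshold 1 - lambda for
    the relaxation parameter t. *)
Lemma relaxation_parameters (a lambda theta eta : R) :
    0 < a -> 0 < lambda < 1 -> 0 < theta < 1 ->
    a < eta < (1 - lambda) * theta / (lambda + theta) ->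
  let beta := (1 - eta) * (1 - theta) in let t := eta / (1 - beta) in
  [/\ 0 < beta < 1, lambda * (1 - theta) <= beta <= 1 - theta,
      t * (1 - beta) = eta, a <= t & a * lambda * theta <= 1 - lambda - t].
Proof.
move=> a0 /andP[l0 l1] /andP[th0 th1] /andP[aeta].
have lt0 : 0 < lambda + theta by lra.
rewrite ltr_pdivlMr// => eta_lt beta t.
have eta1 : eta < 1 - lambda.
  rewrite -(ltr_pM2r lt0); apply: lt_le_trans eta_lt _.
  by rewrite ler_wpM2l//; lra.
have e0 : 0 < eta by lra.
have b0 : 0 < beta by rewrite mulr_gt0; lra.
have b_le : beta <= 1 - theta by rewrite /beta ler_piMl; lra.
have b1 : 0 < 1 - beta by lra.
have tE : t * (1 - beta) = eta by rewrite /t divfK// gt_eqF.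
have alt0 : 0 < a * (lambda * theta) by do 2! apply: mulr_gt0 => //.
split=> //.
- by rewrite b0; lra.
- by rewrite b_le andbT /beta ler_wpM2r; lra.
- rewrite /t ler_pdivlMr//; apply: le_trans (ltW aeta).
  by rewrite ler_piMr ?(ltW a0)//; lra.
- rewrite -(ler_pM2r b1) mulrBl tE.
  have : a * (lambda * theta) <= eta * (lambda * theta).
    by rewrite ler_wpM2r ?mulr_ge0// ltW.
  have := mulr_ge0 (ltW b0) (ltW alt0).
  by move: eta_lt; rewrite /beta; lra.
Qed.

End RelaxationParameters.

(** * Strong convergence of the algorithm *)

Theorem theorem3 (R : realType) (H : hilbertType R) (C : set H)
    (A T : H -> H) (L lambda a delta phi : R)
    (theta zeta eta deltas gamma : nat -> R)
    (x s y z : nat -> H)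
    (C_neq0 : C !=set0) (C_closed : closed C) (C_convex : convex_set C)
    (* (1) *)
    (A_monotone : monotone_map A) (L_gt0 : 0 < L) (A_lip : L.-lipschitz A)
    (* (2) *)
    (lambda01 : 0 <= lambda < 1) (T_demic : demicontractive lambda T)
    (T_demiclosed : demiclosed_at_zero T)
    (* (3) *)
    (sol_neq0 : fixpoints T `&` VI C A !=set0)
    (* (4); the inclusions between intervals are proper, as the statement
       fails for lambda = 0 if they are not *)
    (theta01 : forall k, (1 <= k)%N -> 0 < theta k < 1)
    (theta_cvg : (1 - theta k) @[k --> \oo] --> (0 : R))
    (theta_sum : (\sum_(1 <= k <oo) (1 - theta k)%:E)%E = +oo%E)
    (zeta_gt0 : forall k, (1 <= k)%N -> 0 < zeta k)
    (zeta_cvg : (zeta k / (1 - theta k)) @[k --> \oo] --> (0 : R))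
    (a_gt0 : 0 < a)
    (eta_in : forall k, (1 <= k)%N ->
      [/\ eta k \in `]a, (1 - lambda) * theta k / (lambda + theta k)[,
          [set` `]a, (1 - lambda) * theta k / (lambda + theta k)[]
            `<` [set` `]a, (1 - lambda) / (1 + lambda)[] &
          [set` `]a, (1 - lambda) / (1 + lambda)[]
            `<` [set` `]a, 1 - lambda[] ])
    (delta_gt0 : 0 < delta) (gamma1_gt0 : 0 < gamma 1%N)
    (phi01 : 0 < phi < 1)
    (* the algorithm; x 0 and x 1 are arbitrary *)
    (deltasE : forall k, (1 <= k)%N -> deltas k =
      if x k != x k.-1
      then Num.min (zeta k / `|x k - x k.-1|) delta else delta)
    (sE : forall k, (1 <= k)%N ->
      s k = x k + deltas k *: (x k - x k.-1))
    (yE : forall k, (1 <= k)%N ->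
      y k = metric_proj C (s k - gamma k *: A (s k)))
    (zE : forall k, (1 <= k)%N ->
      z k = metric_proj
        [set w | '[s k - gamma k *: A (s k) - y k, w - y k] <= 0]
        (s k - gamma k *: A (y k)))
    (xE : forall k, (1 <= k)%N ->
      x k.+1 = (1 - eta k) *: (theta k *: z k) + eta k *: T (z k))
    (gammaE : forall k, (1 <= k)%N -> gamma k.+1 =
      if A (s k) - A (y k) != 0
      then Num.min (phi * `|s k - y k| / `|A (s k) - A (y k)|) (gamma k)
      else gamma k) :
  exists u : H,
    [/\ (fixpoints T `&` VI C A) u,
        (forall p : H, (fixpoints T `&` VI C A) p -> `|u| <= `|p|) &
        x k @[k --> \oo] --> u].
Proof.
have [phi0 phi1] := andP phi01; have [lambda0 lambda1] := andP lambda01.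
have lambda_gt0 : 0 < lambda.
  rewrite lt_def lambda0 andbT; apply/negP => /eqP lambdaE.
  (* For lambda = 0 the two larger intervals coincide. *)
  have [_ _ [_]] := eta_in 1%N isT; apply.
  by rewrite lambdaE subr0 addr0 divr1.
have lipA p q : `|A p - A q| <= L * `|p - q| by exact: (A_lip (p, q)).
have [[m m0 m_gamma] step_lip ratio_cvg] :
    [/\ exists2 m, 0 < m & forall k, (1 <= k)%N -> m <= gamma k,
      forall k, (1 <= k)%N ->
        gamma k.+1 * `|A (s k) - A (y k)| <= phi * `|s k - y k| &
      gamma k / gamma k.+1 @[k --> \oo] --> (1 : R)].
  apply: (adaptive_stepsize L_gt0 phi0 gamma1_gt0) => k k1.
    by rewrite normr_ge0 lipA.
  by rewrite gammaE// normr_eq0.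
pose beta k := (1 - eta k) * (1 - theta k).
pose t k := eta k / (1 - beta k).
pose V k := z k - t k *: (z k - T (z k)).
have paramP k : (1 <= k)%N ->
    [/\ 0 < beta k < 1, lambda * (1 - theta k) <= beta k <= 1 - theta k,
        t k * (1 - beta k) = eta k, a <= t k &
        a * lambda * theta k <= 1 - lambda - t k].
  move=> k1; have [+ _ _] := eta_in k k1; rewrite in_itv/=.
  by apply: relaxation_parameters => //; [rewrite lambda_gt0|exact: theta01].
have betaP k : (1 <= k)%N -> [/\ 0 < beta k, beta k < 1,
    lambda * (1 - theta k) <= beta k & beta k <= 1 - theta k].
  by move=> /paramP[/andP[? ?] /andP[? ?] _ _ _].
have tP k : (1 <= k)%N -> [/\ t k * (1 - beta k) = eta k, a <= t k &
    a * lambda * theta k <= 1 - lambda - t k].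
  by move=> /paramP[_ _ ? ? ?].
pose S := fixpoints T `&` VI C A.
have SE : S = [set p | forall x0, [set: H] x0 ->
      '[x0 - T x0, p] <= '[x0 - T x0, x0] - (1 - lambda) / 2 * `|x0 - T x0| ^+ 2]
    `&` (C `&` [set p | forall x0, C x0 -> '[A x0, p] <= '[A x0, x0]]).
  rewrite /S (fixpoints_halfspaces lambda1 T_demic).
  by rewrite (VI_minty C_convex A_monotone L_gt0 lipA).
have S_closed : closed S.
  by rewrite SE; apply: closedI; [|apply: closedI => //]; exact: halfspaces_closed.
have S_convex : convex_set S.
  rewrite SE; apply: convex_setI; [|apply: convex_setI => //];
    exact: halfspaces_convex.
have [Su u_min u_var] := metric_projP 0 sol_neq0 S_closed S_convex.
rewrite -/S in Su u_min u_var; set u := metric_proj S 0 in Su u_min u_var.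
exists u; split=> //.
  by move=> p Sp; have := u_min p Sp; rewrite !sub0r !normrN.
have [Tu VIu] := Su.
pose kappa k := phi * (gamma k / gamma k.+1).
(* kappa_k --> phi < 1, so kappa_k is eventually below the midpoint of phi and
   1. *)
pose kap := (1 + phi) / 2.
have [K [K1 KP]] : exists K, (1 <= K)%N /\
    forall k, (K <= k)%N -> 2^-1 <= theta k /\ kappa k <= kap.
  have half0 : 0 < 2^-1 :> R by [].
  have /cvgr0Pnorm_le/(_ _ half0)[n1 _ n1P] := theta_cvg.
  have kap0 : 0 < kap - phi by rewrite /kap; lra.
  have kappa_cvg : kappa k @[k --> \oo] --> phi * 1 by exact: cvgMl_tmp.
  rewrite mulr1 in kappa_cvg.
  have /cvgrPdist_le/(_ _ kap0)[n2 _ n2P] := kappa_cvg.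
  exists (maxn 1 (maxn n1 n2)); split=> [|k]; first exact: leq_maxl.
  rewrite !geq_max => /andP[k1 /andP[kn1 kn2]]; split.
    by have := le_trans (ler_norm _) (n1P k kn1); lra.
  have := n2P k kn2; rewrite /= distrC => kn.
  by have := le_trans (ler_norm _) kn; lra.
have KP1 k : (K <= k)%N -> (1 <= k)%N by exact: leq_trans K1.
(* A lower bound of t (1 - lambda - t) when theta >= 1/2. *)
pose c := a * (a * lambda / 2).
have c0 : 0 < c by rewrite !mulr_gt0.
pose D k := (1 - kap) * (`|s k - y k| ^+ 2 + `|z k - y k| ^+ 2)
  + c * `|z k - T (z k)| ^+ 2.
have kap1 : 0 < 1 - kap by rewrite /kap; lra.
have D0 k : 0 <= D k.
  have sq0 : 0 <= `|s k - y k| ^+ 2 + `|z k - y k| ^+ 2.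
    by rewrite addr_ge0 ?sqr_ge0.
  by rewrite addr_ge0// mulr_ge0 ?sqr_ge0 ?(ltW c0) ?(ltW kap1).
have VD k : (K <= k)%N -> `|V k - u| ^+ 2 <= `|s k - u| ^+ 2 - D k.
  move=> Kk; have k1 := KP1 k Kk; have [th2 kapk] := KP k Kk.
  have gk : 0 < gamma k := lt_le_trans m0 (m_gamma k k1).
  have gk1 : 0 < gamma k.+1 := lt_le_trans m0 (m_gamma k.+1 isT).
  have lipk : gamma k * `|A (s k) - A (y k)| <= kappa k * `|s k - y k|.
    rewrite /kappa mulrCA -mulrA ler_pM2l// mulrAC ler_pdivlMr// mulrC.
    exact: step_lip.
  have kappa0 : 0 <= kappa k.
    by rewrite /kappa mulr_ge0 ?(ltW phi0)// divr_ge0// ltW.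
  have := extragradient_step C_closed C_convex A_monotone gk VIu (yE k k1)
    (zE k k1) lipk kappa0.
  have [_ at_ tl] := tP k k1.
  have := relaxed_demicontractive (z k) T_demic Tu (le_trans (ltW a_gt0) at_).
  rewrite -/(V k).
  have al0 : 0 < a * lambda by rewrite mulr_gt0.
  have ct : c <= t k * (1 - lambda - t k).
    rewrite /c; apply: ler_pM => //; [exact: ltW|by rewrite divr_ge0// ltW|].
    by apply: le_trans tl; rewrite ler_pM2l.
  have : c * `|z k - T (z k)| ^+ 2 <=
      t k * (1 - lambda - t k) * `|z k - T (z k)| ^+ 2.
    by rewrite ler_wpM2r ?sqr_ge0.
  have : (1 - kap) * (`|s k - y k| ^+ 2 + `|z k - y k| ^+ 2) <=
      (1 - kappa k) * (`|s k - y k| ^+ 2 + `|z k - y k| ^+ 2).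
    by rewrite ler_wpM2r ?addr_ge0 ?sqr_ge0//; lra.
  by rewrite /D; lra.
have xV k : (1 <= k)%N -> x k.+1 = (1 - beta k) *: V k.
  move=> k1; rewrite xE// /V; have [tE _ _] := tP k k1.
  rewrite [RHS]scalerBr [in RHS]scalerA [_ * t k]mulrC tE scalerBr opprB.
  rewrite addrA addrAC scalerA -scalerBl; congr (_ *: _ + _).
  by rewrite /beta; ring.
have beta_cvg : beta @ \oo --> (0 : R).
  apply: (@squeeze_cvgr _ _ _ _ (fun=> 0) (fun k => 1 - theta k)) => //.
    near=> k; have k1 : (1 <= k)%N by near: k; exact: nbhs_infty_ge.
    by have [/ltW -> _ _ ->] := betaP k k1.
  exact: cvg_cst.
apply: (halpern_convergence (s := s) (V := V) (D := D) (beta := beta)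
  (zeta := zeta) (S := S) (K := K)) => //.
- by move=> q Sq; have := u_var q Sq; rewrite sub0r innerNl oppr_le0.
- by move=> k /KP1 k1; have [-> ->] := betaP k k1.
- by move=> k /KP1; exact: xV.
- move=> k /KP1 k1; rewrite sE// addrAC subrr add0r deltasE//.
  have [->|neq] := eqVneq (x k) (x k.-1).
    by rewrite subrr scaler0 normr0 ltW// zeta_gt0.
  have d0 : 0 < `|x k - x k.-1| by rewrite normr_gt0 subr_eq0.
  rewrite normrZ ger0_norm; last by rewrite le_min divr_ge0 ?ltW// zeta_gt0.
  by rewrite -ler_pdivlMr// ge_min lexx.
- rewrite -(mulr0 lambda^-1).
  apply: (@squeeze_cvgr _ _ _ _ (fun=> 0)
    (fun k => lambda^-1 * (zeta k / (1 - theta k)))).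
  + near=> k; have k1 : (1 <= k)%N by near: k; exact: nbhs_infty_ge.
    have [b0 _ lb _] := betaP k k1; have z0 := zeta_gt0 k k1.
    have /andP[_ th1] := theta01 k k1.
    rewrite (divr_ge0 (ltW z0) (ltW b0))/= mulrCA -invfM ler_pM2l//.
    by rewrite lef_pV2// posrE// mulr_gt0// subr_gt0.
  + by rewrite mulr0; exact: cvg_cst.
  + exact: cvgMl_tmp.
- move=> M n0 /KP1 n01.
  have th_ge0 k : (1 <= k)%N -> 0 <= 1 - theta k.
    by move=> /theta01/andP[_ th1]; rewrite subr_ge0 ltW.
  have [n [n0n]] := divergent_tails th_ge0 theta_sum (M / lambda) n01.
  rewrite ltr_pdivrMr// => Mn; exists n; split=> //.
  apply: lt_le_trans Mn _; rewrite mulrC big_distrr/=.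
  apply: ler_sum_nat => k /andP[n0k _].
  by have [] := betaP k (leq_trans n01 n0k).
(* Along f all residuals vanish, so y and z have the weak limit of x. *)
move=> f w B fP xB Df_cvg xw.
have f1 k : (1 <= f k)%N by have [/KP1] := fP k.
have f_oo : f @ \oo --> \oo by apply: cvg_selection => k; have [] := fP k.
have sq0 p q : 0 <= `|p : H| ^+ 2 + `|q : H| ^+ 2 by rewrite addr_ge0 ?sqr_ge0.
have sy_cvg : (s (f k) - y (f k)) @[k --> \oo] --> (0 : H).
  apply: (cvg0_sqr_le kap1 _ Df_cvg) => k; rewrite /D.
  have := mulr_ge0 (ltW c0) (sqr_ge0 `|z (f k) - T (z (f k))|).
  by have := mulr_ge0 (ltW kap1) (sqr_ge0 `|z (f k) - y (f k)|); lra.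
have zy_cvg : (z (f k) - y (f k)) @[k --> \oo] --> (0 : H).
  apply: (cvg0_sqr_le kap1 _ Df_cvg) => k; rewrite /D.
  have := mulr_ge0 (ltW c0) (sqr_ge0 `|z (f k) - T (z (f k))|).
  by have := mulr_ge0 (ltW kap1) (sqr_ge0 `|s (f k) - y (f k)|); lra.
have zT_cvg : (z (f k) - T (z (f k))) @[k --> \oo] --> (0 : H).
  apply: (cvg0_sqr_le c0 _ Df_cvg) => k; rewrite /D.
  by have := mulr_ge0 (ltW kap1) (sq0 (s (f k) - y (f k)) (z (f k) - y (f k))); lra.
have zx_cvg : (z (f k) - x (f k).+1) @[k --> \oo] --> (0 : H).
  apply/norm_cvg0P.
  apply: (@squeeze_cvgr _ _ _ _ (fun=> 0)
    (fun k => 2 * B * beta (f k) + `|z (f k) - T (z (f k))|)).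
  - apply: nearW => k; rewrite normr_ge0/=.
    have [Kf _] := fP k; have [th2 _] := KP _ Kf.
    have [b0 b1 _ b2] := betaP _ (f1 k); have [_ at_ tl] := tP _ (f1 k).
    have /andP[th0 _] := theta01 _ (f1 k).
    have -> : z (f k) - x (f k).+1 =
        beta (f k) *: V (f k) + t (f k) *: (z (f k) - T (z (f k))).
      have zE' : z (f k) = V (f k) + t (f k) *: (z (f k) - T (z (f k))).
        by rewrite /V subrK.
      rewrite {1}zE' xV// scalerBl scale1r opprB.
      by rewrite [LHS]addrC addrA subrK.
    apply: le_trans (ler_normD _ _) _.
    rewrite (normrZ (beta _)) (normrZ (t _)) (gtr0_norm b0).
    rewrite (gtr0_norm (lt_le_trans a_gt0 at_)); apply: lerD.
      rewrite mulrC ler_pM2r//.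
      have := xB k; rewrite xV// normrZ gtr0_norm ?subr_gt0//.
      by have := normr_ge0 (V (f k)); nra.
    have alt0 : 0 < a * lambda * theta (f k) by do 2! apply: mulr_gt0 => //.
    by rewrite ler_piMl//; lra.
  - exact: cvg_cst.
  - rewrite -[X in _ --> X]addr0 -[X in _ --> X + _](mulr0 (2 * B)).
    apply: cvgD; last by rewrite -(@normr0 _ H); exact: cvg_norm.
    by apply: cvgMl_tmp; exact: cvg_comp f_oo beta_cvg.
have zw := weakly_cvg_sub0 xw zx_cvg.
have yz_cvg : (y (f k) - z (f k)) @[k --> \oo] --> (0 : H).
  by rewrite -oppr0; under eq_fun do rewrite -opprB; exact: cvgN.
have yw := weakly_cvg_sub0 zw yz_cvg.
split; first exact: T_demiclosed zw zT_cvg.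
apply: (VI_weak_limit C_closed C_convex A_monotone L_gt0 lipA (m := m)
  (B := B + 1 + 1) (gamma := gamma \o f) (s := s \o f) (y := y \o f)) => //.
- by move=> k; exact: m_gamma.
- by move=> k /=; exact: yE.
- have /cvgr0Pnorm_le/(_ _ ltr01) := yz_cvg.
  have /cvgr0Pnorm_le/(_ _ ltr01) := zx_cvg.
  apply: filterS2 => k zx1 yz1 /=.
  rewrite -[y (f k)](subrK (z (f k))) -[z (f k) in X in _ + X](subrK (x (f k).+1)).
  apply: le_trans (ler_normD _ _) _; rewrite addrC; apply: lerD => //.
  by apply: le_trans (ler_normD _ _) _; rewrite addrC; apply: lerD.
Unshelve. all: by end_near. Qed.
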